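(* Let $\mathbb{K}$ be an infinite field and let $\mathcal{F}$ be a simultaneously orthogonalizable family of inner products on a finite-dimensional $\mathbb{K}$-vector space $V$ such that $\mathrm{rad}(\mathcal{F})=0$. Then there is a family $\mathcal{F}'$ of inner products on $V$ with $\mathcal{F}\sim\mathcal{F}'$ such that $\mathcal{F}'$ has a nondegenerate inner product.
   Context: An inner product on a $\mathbb{K}$-vector space $V$ means a symmetric bilinear form $V\times V\to\mathbb{K}$ (possibly degenerate). Families are nonempty. The radical of an inner product is $\mathrm{rad}(\langle\cdot,\cdot\rangle)=\{x\in V:\langle x,y\rangle=0\ \forall y\in V\}$; the inner product is nondegenerate if its radical is $0$. The radical of a family, $\mathrm{rad}(\mathcal{F})$, is the intersection of the radicals of its members. A family is simultaneously orthogonalizable if there is a single basis $\{v_j\}$ of $V$ such that $\langle v_j,v_k\rangle=0$ whenever $j\neq k$, for every inner product in the family (isotropic basis vectors are allowed). Two families $\mathcal{F},\mathcal{F}'$ of inner products on $V$ are equivalent, written $\mathcal{F}\sim\mathcal{F}'$, if they have the same $\mathbb{K}$-linear span in the space of bilinear forms $V\times V\to\mathbb{K}$. *)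

(* Defs.v *)
From HB Require Import structures.
From mathcomp Require Import all_boot all_algebra.
From mathcomp Require Import boolp classical_sets cardinality.

Set Implicit Arguments.
Unset Strict Implicit.
Unset Printing Implicit Defensive.

Import GRing.Theory.
Local Open Scope classical_set_scope.
Local Open Scope ring_scope.

(* An inner product on V is a symmetric bilinear form, possibly degenerate:
   an element of {symmetric V}.  A family of inner products is represented by
   the set of its members; nonemptiness is a separate hypothesis. *)

Definition rad (K : fieldType) (V : vectType K) (phi : {symmetric V}) :
    {vspace V} :=
  orthov phi fullv.

Lemma radP (K : fieldType) (V : vectType K) (phi : {symmetric V}) (x : V) :
  x \in rad phi <-> forall y : V, phi x y = 0.
Proof.
split=> [/mem_orthovP xP y | xP]; first exact/xP/memvf.
by apply/mem_orthovP => y _.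
Qed.

Lemma nondegenerateE (K : fieldType) (V : vectType K) (phi : {symmetric V}) :
  nondegenerate phi = (rad phi == 0%VS).
Proof. by []. Qed.

Definition rad_family (K : fieldType) (V : vectType K)
    (F : set {symmetric V}) : set V :=
  \bigcap_(phi in F) [set x | x \in rad phi].

(* Isotropic basis vectors are allowed: nothing is required of
   [phi (tnth e i) (tnth e i)]. *)
Definition simultaneously_orthogonalizable (K : fieldType) (V : vectType K)
    (F : set {symmetric V}) : Prop :=
  exists e : (\dim {:V}).-tuple V, basis_of fullv e /\
    forall phi : {symmetric V}, F phi ->
    forall i j : 'I_(\dim {:V}), i != j -> phi (tnth e i) (tnth e j) = 0.

(* The K-linear span of F in the space of all bilinear forms on V, i.e. the
   finite linear combinations of members of F; the type of bundled bilinear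
   forms carries no module structure, so these are spelled out pointwise. *)
Definition linear_span (K : fieldType) (V : vectType K)
    (F : set {symmetric V}) : set {bilinear V -> V -> K | *%R & *%R} :=
  [set b | exists (n : nat) (c : 'I_n -> K) (phi : 'I_n -> {symmetric V}),
     (forall i : 'I_n, F (phi i)) /\
     (forall x y : V, b x y = \sum_(i < n) c i * phi i x y)].

Definition family_equiv (K : fieldType) (V : vectType K)
    (F F' : set {symmetric V}) : Prop :=
  linear_span F = linear_span F'.

(* Main.v *)
(** Fix an orthogonalizing basis [e].  Since [rad F = 0], every [e i] is
    non-isotropic for some [phi i] in [F].  The value of
    [psi t := \sum_i t ^ i phi i] at [(e j, e j)] is a nonzero polynomial in
    [t], so over an infinite field some [t] makes all of them nonzero.  Then
    [psi t] is diagonal in [e] without zero on the diagonal, hence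
    nondegenerate, and adjoining it to [F] does not change the span. *)
Require Import Defs.
From HB Require Import structures.
From mathcomp Require Import all_boot all_algebra.
From mathcomp Require Import boolp classical_sets cardinality.

Set Implicit Arguments.
Unset Strict Implicit.
Unset Printing Implicit Defensive.

Import GRing.Theory.
Local Open Scope classical_set_scope.
Local Open Scope ring_scope.

(** A nonzero [p] has fewer than [size p] distinct roots, while an infinite field contains a finite
    set of at least [size p] points. *)
Lemma infinite_field_nonroot (K : fieldType) (p : {poly K}) :
  infinite_set [set: K] -> p != 0 -> exists t : K, p.[t] != 0.
Proof.
move=> Kinf p0; have [B _ sB] := infinite_set_fset (size p) Kinf.
apply: contrapT => /forallNP proot.
have rB : all (root p) (finmap.enum_fset B).
  by apply/allP => t _; apply: contrapT => /negP; exact: proot.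
by have := max_poly_roots p0 rB (finmap.fset_uniq B); rewrite ltnNge sB.
Qed.

Section SymmetricLinearCombination.
Variables (K : fieldType) (V : vectType K) (n : nat).
Variables (c : 'I_n -> K) (phi : 'I_n -> {symmetric V}).

Definition sym_lincomb (x y : V) : K := \sum_(i < n) c i * phi i x y.

(** Symmetry in the Hermitian format: sign [(-1) ^+ false = 1] and the identity as involution. *)
Let sym_lincombC x y : sym_lincomb x y = (-1) ^+ false * idfun (sym_lincomb y x).
Proof.
rewrite expr0 mul1r; apply: eq_bigr => i _.
by rewrite [in LHS]hermitian_subproof expr0 mul1r.
Qed.

Let sym_lincomb_linear x : scalar (sym_lincomb x).
Proof.
move=> a y z; rewrite /sym_lincomb mulr_sumr -big_split; apply: eq_bigr => i _ /=.
by rewrite linearPr mulrDr mulrCA.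
Qed.

Let sym_lincomb_bilinear : bilinear_for
  (GRing.Scale.Law.clone _ _ *%R _) (GRing.Scale.Law.clone _ _ (idfun \; *%R) _)
  sym_lincomb.
Proof.
split=> [y|x]; last exact: sym_lincomb_linear.
move=> a x z /=; rewrite ![sym_lincomb _ y]sym_lincombC !expr0 !mul1r.
exact: sym_lincomb_linear.
Qed.

HB.instance Definition _ := bilinear_isBilinear.Build K V V K
  (GRing.Scale.Law.clone _ _ *%R _) (GRing.Scale.Law.clone _ _ (idfun \; *%R) _)
  sym_lincomb sym_lincomb_bilinear.
HB.instance Definition _ :=
  isHermitianSesquilinear.Build K V false idfun sym_lincomb sym_lincombC.

End SymmetricLinearCombination.

Section Span.
Variables (K : fieldType) (V : vectType K).
Implicit Types (F G : set {symmetric V}) (f g : V -> V -> K).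

(** The condition defining [linear_span], stated for a bare function so that sums can be handled
    without bundling them as bilinear forms. *)
Definition is_lincomb F f : Prop :=
  exists (n : nat) (c : 'I_n -> K) (phi : 'I_n -> {symmetric V}),
    (forall i : 'I_n, F (phi i)) /\
    (forall x y : V, f x y = \sum_(i < n) c i * phi i x y).

Lemma is_lincomb_mem F (phi : {symmetric V}) : F phi -> is_lincomb F phi.
Proof.
move=> Fphi; exists 1%N, (fun=> 1), (fun=> phi); split=> // x y.
by rewrite big_ord1 mul1r.
Qed.

Lemma is_lincombPD F a f g :
  is_lincomb F f -> is_lincomb F g ->
  is_lincomb F (fun x y => a * f x y + g x y).
Proof.
move=> [m [c [phi [Fphi fE]]]] [n [d [psi [Fpsi gE]]]].
(* Concatenate the two combinations; [split] tells which one an index comes from. *)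
exists (m + n)%N.
exists (fun i => match split i with inl j => a * c j | inr j => d j end).
exists (fun i => match split i with inl j => phi j | inr j => psi j end).
split=> [i|x y]; first by case: split.
rewrite big_split_ord fE gE mulr_sumr; congr (_ + _); apply: eq_bigr => i _.
  by rewrite (unsplitK (inl i)) mulrA.
by rewrite (unsplitK (inr i)).
Qed.

Lemma is_lincomb_sum F (n : nat) (c : 'I_n -> K) (f : 'I_n -> V -> V -> K) :
  (forall i, is_lincomb F (f i)) ->
  is_lincomb F (fun x y => \sum_(i < n) c i * f i x y).
Proof.
elim: n c f => [|n IHn] c f Ff.
  (* [F] may be empty here, so the empty combination uses the family over the empty type ['I_0]. *)
  have phi : 'I_0 -> {symmetric V} by case.
  exists 0%N, (fun=> 0), phi.
  by split=> [[]//|x y]; rewrite !big_ord0.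
have := is_lincombPD (c ord0) (Ff ord0)
  (IHn (c \o lift ord0) (f \o lift ord0) (fun i => Ff _)).
move=> [m [d [phi [Fphi E]]]]; exists m, d, phi; split=> // x y.
by rewrite -E big_ord_recl.
Qed.

Lemma linear_span_sub F G :
  (forall phi, F phi -> is_lincomb G phi) -> linear_span F `<=` linear_span G.
Proof.
move=> FG b [n [c [phi [Fphi bE]]]].
have [m [d [psi [Gpsi E]]]] := is_lincomb_sum c (fun i => FG _ (Fphi i)).
by exists m, d, psi; split=> // x y; rewrite bE E.
Qed.

End Span.

Section Diagonal.
Variables (K : fieldType) (V : vectType K) (e : (\dim {:V}).-tuple V).
Hypothesis e_basis : basis_of fullv e.
Implicit Types phi : {symmetric V}.

Let e_expand x : x = \sum_i coord e i x *: tnth e i.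
Proof.
rewrite {1}(coord_basis e_basis (memvf x)).
by apply: eq_bigr => i _; rewrite (tnth_nth 0).
Qed.

Lemma diagonal_formE phi :
  (forall i j, i != j -> phi (tnth e i) (tnth e j) = 0) ->
  forall x j, phi x (tnth e j) = coord e j x * phi (tnth e j) (tnth e j).
Proof.
move=> phi_diag x j; rewrite {1}(e_expand x) linear_sumlz (bigD1 j) //= big1.
  by rewrite addr0 linearZl_LR.
by move=> i ij; rewrite linearZl_LR /= phi_diag ?mulr0.
Qed.

Lemma diagonal_mem_rad phi j :
  (forall i j, i != j -> phi (tnth e i) (tnth e j) = 0) ->
  phi (tnth e j) (tnth e j) = 0 -> tnth e j \in Defs.rad phi.
Proof.
move=> phi_diag phij; apply/radP => y.
rewrite (e_expand y) linear_sumr big1 // => i _; rewrite linearZr_LR /=.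
by have [<-|ji] := eqVneq j i; rewrite ?phij ?phi_diag ?mulr0.
Qed.

(** Pairing a radical vector with [e j] gives its [j]-th coordinate times a nonzero scalar, so all
    its coordinates vanish. *)
Lemma diagonal_nondegenerate phi :
  (forall i j, i != j -> phi (tnth e i) (tnth e j) = 0) ->
  (forall j, phi (tnth e j) (tnth e j) != 0) -> nondegenerate phi.
Proof.
move=> phi_diag phi_neq0; rewrite nondegenerateE -subv0.
apply/subvP => x /radP xrad; rewrite memv0 (e_expand x) big1 // => j _.
have /eqP := xrad (tnth e j).
by rewrite diagonal_formE // mulf_eq0 (negPf (phi_neq0 j)) orbF => /eqP ->; rewrite scale0r.
Qed.

End Diagonal.

Theorem theorem2 (K : fieldType) (V : vectType K) (F : set {symmetric V})
    (Kinf : infinite_set [set: K])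
    (Fne : F !=set0)
    (Forth : simultaneously_orthogonalizable F)
    (Frad : rad_family F = [set 0]) :
  exists F' : set {symmetric V},
    [/\ F' !=set0,
        family_equiv F F' &
        exists2 phi : {symmetric V}, F' phi & nondegenerate phi].
Proof.
have [e [e_basis F_diag]] := Forth.
have e_neq0 i : tnth e i != 0.
  apply/eqP => ei0; have := basis_free e_basis; rewrite free_directv => /andP[/negP e0 _].
  by apply: e0; rewrite -ei0 mem_tnth.
have /choice[phi phiP] i : exists phi : {symmetric V},
    F phi /\ phi (tnth e i) (tnth e i) != 0.
  (* Otherwise [e i] is isotropic for every member of [F], hence lies in [rad_family F =
     [set 0]]. *)
  apply: contrapT => /forallNP phi0; apply/negP: (e_neq0 i); rewrite negbK.
  suff: rad_family F (tnth e i) by rewrite Frad => /= ->.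
  move=> phi Fphi; apply: (diagonal_mem_rad e_basis); first exact: F_diag.
  by apply: contrapT => /eqP phi_i; apply: (phi0 phi).
have Fphi i : F (phi i) by case: (phiP i).
(* [(p j).[t]] is the value at [(e j, e j)] of the combination with weights [t ^+ i]. The default 0
   is never reached, as [i < \dim {:V}]. *)
pose p j := \poly_(i < \dim {:V})
  (if insub i is Some i' then phi i' (tnth e j) (tnth e j) else 0).
have p_neq0 j : p j != 0.
  (* The coefficient of degree [j] in [p j] is nonzero by the choice of [phi j]. *)
  apply: contra_neq (phiP j).2 => pj0.
  by have := congr1 (coefp j) pj0; rewrite /= coef_poly coef0 ltn_ord valK.
(* A nonroot of the product serves all [j] at once. *)
have [|t] := infinite_field_nonroot Kinf (p := \prod_j p j).
  by rewrite prodf_seq_neq0; apply/allP => j _; rewrite p_neq0.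
rewrite horner_prod prodf_seq_neq0 => /allP t_nonroot.
pose psi : {symmetric V} := sym_lincomb (fun i => t ^+ i) phi.
exists (F `|` [set psi]); split.
- by exists psi; right.
- apply/seteqP; split; apply: linear_span_sub => f.
    by move=> Ff; apply: is_lincomb_mem; left.
  (* The adjoined [psi] is itself a combination of the [phi i], so it adds nothing to the span. *)
  move=> [Ff|->]; first exact: is_lincomb_mem.
  by apply: is_lincomb_sum => i; apply: is_lincomb_mem.
- exists psi; first by right.
  apply: (diagonal_nondegenerate e_basis) => [i j ij|j].
    by rewrite /psi /= /sym_lincomb big1 // => k _; rewrite F_diag ?mulr0.
  have := t_nonroot j (mem_index_enum j); rewrite /= /p horner_poly.
  by congr (_ != 0); apply: eq_bigr => i _; rewrite valK mulrC.
Qed.
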